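(* Let $n\ge4$ and let $\mathbf z=(z_\alpha)_{\alpha\in I_n^{\mathrm{CM}}}$ be a coherent Cayley-Menger frieze of order $n$ such that (i) $z_{(i,j)}\ne0$ for all $(i,j)\in\mathbb Z^2$ with $2\le j-i\le n-2$; (ii) $H(z_{(i,j)},z_{(i+1,j)},z_{(i+\frac12,/)})\ne0$ and $H(z_{(i,j-1)},z_{(i,j)},z_{(\backslash,j-\frac12)})\ne0$ for all $(i,j)\in\mathbb Z^2$ with $2\le j-i\le n-1$. Let $\pi$ be an arbitrary traversing path, with thickening $\overline\pi$. Then $\mathbf z$ is uniquely determined by its entries belonging to $\overline\pi$; that is, any coherent Cayley-Menger frieze of order $n$ satisfying (i) and (ii) whose entries indexed by $\overline\pi$ agree with those of $\mathbf z$ equals $\mathbf z$.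
   Context: $H(p,q,r)=-p^2-q^2-r^2+2pq+2pr+2qr$. The Cayley-Menger polynomial is $$M(a,b,c,d,e,f)=\det\begin{bmatrix}0&1&1&1&1\\1&0&b&e&a\\1&b&0&c&f\\1&e&c&0&d\\1&a&f&d&0\end{bmatrix}.$$ A Cayley-Menger diamond is a 6-tuple $(a,b,c,d,e,f)\in\mathbb C^6$ with $M(a,b,c,d,e,f)=0$. Notation: $\partial_\uparrow M=\partial M/\partial a$, $\partial_\downarrow M=\partial M/\partial c$, $\partial_\leftarrow M=\partial M/\partial e$, $\partial_\rightarrow M=\partial M/\partial f$. For $n\ge4$ let $L_n=\{(i+\frac12,/):i\in\mathbb Z\}\cup\{(\backslash,j+\frac12):j\in\mathbb Z\}$ (formal indices called lines) and $I_n^{\mathrm{CM}}=\{(i,j)\in\mathbb Z^2:0\le j-i\le n\}\cup L_n$. For an array $\mathbf z=(z_\alpha)_{\alpha\in I_n^{\mathrm{CM}}}$ of complex numbers and $(i,j)\in\mathbb Z^2$ with $1\le j-i\le n-1$ put $$\Diamond_{i,j}(\mathbf z)=(z_{(i,j+1)},z_{(i+\frac12,/)},z_{(i+1,j)},z_{(\backslash,j+\frac12)},z_{(i,j)},z_{(i+1,j+1)}).$$ A Cayley-Menger frieze of order $n$ is such an array in which every $\Diamond_{i,j}(\mathbf z)$, $1\le j-i\le n-1$, is a Cayley-Menger diamond and, for all $i\in\mathbb Z$: $z_{(i,i)}=0$, $z_{(i,i+1)}=z_{(i+\frac12,/)}=z_{(\backslash,i+\frac12)}$, $z_{(i,i+n)}=0$,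 $z_{(i,i+n-1)}=z_{(i-\frac12,/)}=z_{(\backslash,i+n-\frac12)}$. It is coherent if for all $(i,j)\in\mathbb Z^2$ with $2\le j-i\le n-2$ $$\partial_\leftarrow M(\Diamond_{i-1,j-1}(\mathbf z))\,\partial_\rightarrow M(\Diamond_{i,j}(\mathbf z))=\partial_\uparrow M(\Diamond_{i-1,j}(\mathbf z))\,\partial_\downarrow M(\Diamond_{i,j-1}(\mathbf z)).$$ A traversing path for an order $n$ Cayley-Menger frieze is a collection $\pi=((i_1,j_1),\dots,(i_{n-1},j_{n-1}),\ell_1,\dots,\ell_{n-2})$ of $2n-3$ indices in $I_n^{\mathrm{CM}}$ such that: $(i_k,j_k)\in\mathbb Z^2$ with $j_k-i_k=k$ for $1\le k\le n-1$; $|i_{k+1}-i_k|+|j_{k+1}-j_k|=1$ for $1\le k\le n-2$; $\ell_k\in L_n$, with $\ell_k=(i_k-\frac12,/)$ if $j_{k+1}=j_k$ and $\ell_k=(\backslash,j_k+\frac12)$ if $i_{k+1}=i_k$. Its thickening $\overline\pi$ is $\pi$ together with the nodes $(i_1+1,j_1+1),\dots,(i_{n-1}+1,j_{n-1}+1)$. *)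

(* Defs.v *)
From HB Require Import structures.
From mathcomp Require Import all_boot all_order all_algebra.
From mathcomp Require Import complex reals.
From mathcomp Require Import mpoly.

Set Implicit Arguments.
Unset Strict Implicit.
Unset Printing Implicit Defensive.

Import Order.TTheory GRing.Theory Num.Theory.
Local Open Scope ring_scope.
Local Open Scope complex_scope.

Definition heron (A : comNzRingType) (p q r : A) : A :=
  - p ^+ 2 - q ^+ 2 - r ^+ 2 + 2 * p * q + 2 * p * r + 2 * q * r.

Definition cm_matrix (A : comNzRingType) (a b c d e f : A) : 'M[A]_5 :=
  \matrix_(i < 5, j < 5) nth 0 (nth [::] [::
    [:: 0; 1; 1; 1; 1];
    [:: 1; 0; b; e; a];
    [:: 1; b; 0; c; f];
    [:: 1; e; c; 0; d];
    [:: 1; a; f; d; 0]] i) j.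

(* The variables a, b, c, d, e, f are 'X_0, ..., 'X_5 in this order. *)
Definition cm_poly (A : comNzRingType) : {mpoly A[6]} :=
  let x (k : nat) : {mpoly A[6]} := 'X_(inord k) in
  \det (cm_matrix (x 0%N) (x 1%N) (x 2%N) (x 3%N) (x 4%N) (x 5%N)).

Definition cm_eval (A : comNzRingType) (p : {mpoly A[6]}) (t : 6.-tuple A) : A :=
  p.@[tnth t].

Definition cm_diamond (A : comNzRingType) (t : 6.-tuple A) : Prop :=
  cm_eval (cm_poly A) t = 0.

Definition dM_up (A : comNzRingType) (t : 6.-tuple A) : A :=
  cm_eval (cm_poly A)^`M(inord 0%N) t.
Definition dM_down (A : comNzRingType) (t : 6.-tuple A) : A :=
  cm_eval (cm_poly A)^`M(inord 2%N) t.
Definition dM_left (A : comNzRingType) (t : 6.-tuple A) : A :=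
  cm_eval (cm_poly A)^`M(inord 4%N) t.
Definition dM_right (A : comNzRingType) (t : 6.-tuple A) : A :=
  cm_eval (cm_poly A)^`M(inord 5%N) t.

(* [slash i] is the line (i + 1/2, /) and [backslash j] the line
   (\, j + 1/2): half-integers are represented by their floor. *)
Variant cm_index :=
  | node of int & int
  | slash of int
  | backslash of int.

Definition is_line (x : cm_index) : bool :=
  if x is node _ _ then false else true.

Definition in_ICM (n : nat) (x : cm_index) : bool :=
  if x is node i j then 0 <= j - i <= n%:Z else is_line x.

(* Arrays indexed by I_n^CM are represented by functions on all of [cm_index].
   The predicates below only read entries at indices satisfying [in_ICM n], and
   two arrays of order n are identified when they agree at those indices. *)
Definition cm_array (R : realType) := cm_index -> R[i].

Definition eq_array (R : realType) (n : nat) (z w : cm_array R) : Prop :=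
  forall x : cm_index, in_ICM n x -> z x = w x.

Definition diamond (R : realType) (z : cm_array R) (i j : int) :
    6.-tuple R[i] :=
  [tuple z (node i (j + 1)); z (slash i); z (node (i + 1) j);
         z (backslash j); z (node i j); z (node (i + 1) (j + 1))].

Definition cm_frieze (R : realType) (n : nat) (z : cm_array R) : Prop :=
  (forall i j : int, 1 <= j - i <= n%:Z - 1 -> cm_diamond (diamond z i j)) /\
  forall i : int,
    [/\ z (node i i) = 0,
        z (node i (i + 1)) = z (slash i) /\ z (slash i) = z (backslash i),
        z (node i (i + n%:Z)) = 0
      & z (node i (i + n%:Z - 1)) = z (slash (i - 1)) /\
        z (slash (i - 1)) = z (backslash (i + n%:Z - 1))].

Definition coherent (R : realType) (n : nat) (z : cm_array R) : Prop :=
  forall i j : int, 2 <= j - i <= n%:Z - 2 ->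
    dM_left (diamond z (i - 1) (j - 1)) * dM_right (diamond z i j) =
    dM_up (diamond z (i - 1) j) * dM_down (diamond z i (j - 1)).

Definition nonzero_nodes (R : realType) (n : nat) (z : cm_array R) : Prop :=
  forall i j : int, 2 <= j - i <= n%:Z - 2 -> z (node i j) != 0.

Definition nonzero_heron (R : realType) (n : nat) (z : cm_array R) : Prop :=
  forall i j : int, 2 <= j - i <= n%:Z - 1 ->
    heron (z (node i j)) (z (node (i + 1) j)) (z (slash i)) != 0 /\
    heron (z (node i (j - 1))) (z (node i j)) (z (backslash (j - 1))) != 0.

(* A path of order n consists of the nodes (path_i k, path_j k) for
   1 <= k <= n - 1 and the lines path_line k for 1 <= k <= n - 2; values at
   other k are irrelevant. *)
Record cm_path := CMPath {
  path_i : nat -> int;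
  path_j : nat -> int;
  path_line : nat -> cm_index }.

Definition traversing (n : nat) (p : cm_path) : Prop :=
  [/\ forall k : nat, (1 <= k <= n - 1)%N -> path_j p k - path_i p k = k%:Z,
      forall k : nat, (1 <= k <= n - 2)%N ->
        `|path_i p k.+1 - path_i p k| + `|path_j p k.+1 - path_j p k| = 1 :> int
    & forall k : nat, (1 <= k <= n - 2)%N ->
        [/\ is_line (path_line p k),
            path_j p k.+1 = path_j p k ->
              path_line p k = slash (path_i p k - 1)
          & path_i p k.+1 = path_i p k ->
              path_line p k = backslash (path_j p k)]].

Definition in_path (n : nat) (p : cm_path) (x : cm_index) : Prop :=
  (exists2 k : nat, (1 <= k <= n - 1)%N & x = node (path_i p k) (path_j p k)) \/
  (exists2 k : nat, (1 <= k <= n - 2)%N & x = path_line p k).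

Definition in_thickening (n : nat) (p : cm_path) (x : cm_index) : Prop :=
  in_path n p x \/
  exists2 k : nat, (1 <= k <= n - 1)%N &
    x = node (path_i p k + 1) (path_j p k + 1).

(* Main.v *)
(** Write e and f for the left and right entries of a diamond. As a polynomial
    in e, M has leading coefficient -2f, and its discriminant is 4 times the
    product of the Heron polynomials of the two faces containing f. On a
    diamond the square of dM/de equals this discriminant, so (ii) makes dM/de
    nonzero; likewise dM/df. Coherence at (i, j) then gives dM/df on the
    diamond to the right of (i, j) in terms of the entries around (i, j), and
    dM/df is affine in f with slope -4 z_(i,j), which is nonzero by (i). Hence
    z_(i+1,j+1) is determined by the other eight nodes of the 3x3 block centred
    at (i, j) and the surrounding lines, and symmetrically for z_(i-1,j-1).
    All other nodes of the block have a smaller (resp. larger) coordinate sum,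
    so the values spread from the thickened path by induction on i + j. The
    lines are n-periodic, the two lines through i + 1/2 carry the same value,
    and a traversing path meets n consecutive ones. *)

Require Import Defs.
From mathcomp Require Import all_boot all_order all_algebra.
From mathcomp Require Import complex reals.
From mathcomp Require Import mpoly.
From mathcomp Require Import zify ring.

Set Implicit Arguments.
Unset Strict Implicit.
Unset Printing Implicit Defensive.

Import Order.TTheory GRing.Theory Num.Theory.
Local Open Scope ring_scope.

(** * Explicit formulas for the Cayley-Menger determinant and its derivatives *)

(* Indexing entries by [nat] rather than ['I_n] lets concrete determinants
   unfold by [simpl]. *)
Fixpoint laplace_det (A : comNzRingType) (n : nat) (F : nat -> nat -> A) : A :=
  if n is m.+1 then
    foldr (fun j s => F 0%N j * ((-1) ^+ j *
                      laplace_det m (fun i k => F i.+1 (bump j k))) + s)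
      0 (iota 0 m.+1)
  else 1.

Lemma det_matrix_nat (A : comNzRingType) (n : nat) (F : nat -> nat -> A) :
  \det (\matrix_(i < n, j < n) F i j) = laplace_det n F.
Proof.
elim: n F => [|n IHn] F; first by rewrite det_mx00.
rewrite (expand_det_row _ ord0).
transitivity (\sum_(0 <= j < n.+1) F 0%N j * ((-1) ^+ j *
    laplace_det n (fun i k => F i.+1 (bump j k)))); last by rewrite unlock.
rewrite big_mkord; apply: eq_bigr => j _.
rewrite mxE /cofactor add0n -IHn; congr (_ * (_ * \det _)).
by apply/matrixP => i k; rewrite !mxE.
Qed.

(** This is 288 times the squared volume of a tetrahedron with squared edge lengths a, ..., f. The
    pairs (a, c), (b, d), (e, f) are opposite edges, and the last four products run over the
    faces. *)
Definition cayley_menger (A : comNzRingType) (a b c d e f : A) : A :=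
  2 * (a * c * (b + d + e + f - a - c) + b * d * (a + c + e + f - b - d)
       + e * f * (a + b + c + d - e - f)
       - b * c * e - a * b * f - a * d * e - c * d * f).

Lemma det_cm_matrix (A : comNzRingType) (a b c d e f : A) :
  \det (cm_matrix a b c d e f) = cayley_menger a b c d e f.
Proof.
rewrite /cm_matrix (det_matrix_nat _ (fun i j => nth 0 (nth [::] _ i) j)) /=.
rewrite /cayley_menger; ring.
Qed.

Lemma mderivXU (n : nat) (A : comNzRingType) (i j : 'I_n) :
  ('X_i : {mpoly A[n]})^`M(j) = (i == j)%:R.
Proof.
rewrite mderivX mnm1E; case: eqP => [->|_]; last by rewrite scale0r.
rewrite scale1r -mpolyX0; congr (mpolyX _ _).
by apply/mnmP => k; rewrite mnmBE mnm0E subnn.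
Qed.

Lemma cm_diamondE (A : comNzRingType) (a b c d e f : A) :
  cm_diamond [tuple a; b; c; d; e; f] <-> cayley_menger a b c d e f = 0.
Proof.
rewrite /cm_diamond /cm_eval /cm_poly det_cm_matrix /cayley_menger.
rewrite !(mevalD, mevalM, mevalB, mevalN, mevalXU, rmorphMn, rmorph1).
by rewrite !(tnth_nth 0) !inordK.
Qed.

Lemma dM_leftE (A : comNzRingType) (a b c d e f : A) :
  dM_left [tuple a; b; c; d; e; f] =
  2 * (a * c + b * d + f * (a + b + c + d - f - 2 * e) - b * c - a * d).
Proof.
rewrite /dM_left /cm_eval /cm_poly det_cm_matrix /cayley_menger.
rewrite -mpolyC1 !(mderivD, mderivB, mderivM, mderivN, mderivC, mderivXU).
rewrite -!val_eqE /= !inordK //=.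
rewrite !(mul0r, mulr0, mulr1, mul1r, addr0, add0r, subr0, sub0r).
rewrite !(mevalD, mevalM, mevalB, mevalN, mevalXU, rmorphMn, rmorph1).
rewrite !(tnth_nth 0) !inordK //=; ring.
Qed.

Lemma dM_rightE (A : comNzRingType) (a b c d e f : A) :
  dM_right [tuple a; b; c; d; e; f] =
  2 * (a * c + b * d + e * (a + b + c + d - e - 2 * f) - a * b - c * d).
Proof.
rewrite /dM_right /cm_eval /cm_poly det_cm_matrix /cayley_menger.
rewrite -mpolyC1 !(mderivD, mderivB, mderivM, mderivN, mderivC, mderivXU).
rewrite -!val_eqE /= !inordK //=.
rewrite !(mul0r, mulr0, mulr1, mul1r, addr0, add0r, subr0, sub0r).
rewrite !(mevalD, mevalM, mevalB, mevalN, mevalXU, rmorphMn, rmorph1).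
rewrite !(tnth_nth 0) !inordK //=; ring.
Qed.

(** A quadratic q with leading coefficient A satisfies q'^2 = disc(q) + 4 A q; here A = -2f. *)
Lemma dM_left_sqr (A : comNzRingType) (a b c d e f : A) :
  dM_left [tuple a; b; c; d; e; f] ^+ 2 =
  4 * heron a f b * heron c f d - 8 * f * cayley_menger a b c d e f.
Proof. rewrite dM_leftE /heron /cayley_menger; ring. Qed.

Lemma dM_right_sqr (A : comNzRingType) (a b c d e f : A) :
  dM_right [tuple a; b; c; d; e; f] ^+ 2 =
  4 * heron e c b * heron e a d - 8 * e * cayley_menger a b c d e f.
Proof. rewrite dM_rightE /heron /cayley_menger; ring. Qed.

(** * Coherence determines one corner of a 3x3 block *)

Lemma node_right_determined (R : realType) (n : nat) (z w : cm_array R)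
    (i j : int) :
  2 <= j - i <= n%:Z - 2 ->
  cm_frieze n z -> nonzero_nodes n z -> nonzero_heron n z ->
  coherent n z -> coherent n w ->
  (forall k, w (slash k) = z (slash k)) ->
  (forall k, w (backslash k) = z (backslash k)) ->
  (forall i' j', i - 1 <= i' <= i + 1 -> j - 1 <= j' <= j + 1 ->
     i' + j' < (i + 1) + (j + 1) -> w (node i' j') = z (node i' j')) ->
  w (node (i + 1) (j + 1)) = z (node (i + 1) (j + 1)).
Proof.
move=> ij_n [z_cm _] z_nodes z_heron z_coh w_coh eq_slash eq_backslash eq_node.
have z_left : dM_left (diamond z (i - 1) (j - 1)) != 0.
  rewrite -sqrf_eq0 /diamond dM_left_sqr !subrK.
  have: cm_diamond (diamond z (i - 1) (j - 1)).
    by apply: z_cm; lia.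
  rewrite /diamond !subrK => /cm_diamondE ->; rewrite mulr0 subr0.
  (* The two faces of the diamond at (i - 1, j - 1) that contain its right entry [z (node i j)]. *)
  have [|H1 _] := z_heron (i - 1) j; first by lia.
  have [|_ H2] := z_heron i j; first by lia.
  by rewrite subrK in H1; rewrite !mulf_neq0 // pnatr_eq0.
have eq_left : diamond w (i - 1) (j - 1) = diamond z (i - 1) (j - 1).
  by rewrite /diamond !subrK !eq_slash !eq_backslash !eq_node //; lia.
have eq_up : diamond w (i - 1) j = diamond z (i - 1) j.
  by rewrite /diamond !subrK !eq_slash !eq_backslash !eq_node //; lia.
have eq_down : diamond w i (j - 1) = diamond z i (j - 1).
  by rewrite /diamond !subrK !eq_slash !eq_backslash !eq_node //; lia.
have: dM_right (diamond w i j) = dM_right (diamond z i j).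
  (* The other three factors of the coherence relation come from diamonds that avoid the node (i +
     1, j + 1), so they agree for [w] and [z]. *)
  apply: (mulfI z_left); rewrite z_coh // -eq_left -eq_up -eq_down.
  exact: w_coh.
rewrite /diamond !dM_rightE !eq_slash !eq_backslash.
rewrite !(eq_node i, eq_node (i + 1) j); try lia.
set a := z (node i (j + 1)); set b := z (slash i).
set c := z (node (i + 1) j); set d := z (backslash j).
set e := z (node i j); set f := w _; set g := z (node (i + 1) _).
move/eqP; rewrite -subr_eq0 => /eqP E.
have: 4 * e * (g - f) = 0 by rewrite -E; ring.
by move/eqP; rewrite !mulf_eq0 pnatr_eq0 (negPf (z_nodes _ _ _)) //= subr_eq0
  => /eqP.
Qed.

Lemma node_left_determined (R : realType) (n : nat) (z w : cm_array R)
    (i j : int) :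
  2 <= j - i <= n%:Z - 2 ->
  cm_frieze n z -> nonzero_nodes n z -> nonzero_heron n z ->
  coherent n z -> coherent n w ->
  (forall k, w (slash k) = z (slash k)) ->
  (forall k, w (backslash k) = z (backslash k)) ->
  (forall i' j', i - 1 <= i' <= i + 1 -> j - 1 <= j' <= j + 1 ->
     (i - 1) + (j - 1) < i' + j' -> w (node i' j') = z (node i' j')) ->
  w (node (i - 1) (j - 1)) = z (node (i - 1) (j - 1)).
Proof.
move=> ij_n [z_cm _] z_nodes z_heron z_coh w_coh eq_slash eq_backslash eq_node.
have z_right : dM_right (diamond z i j) != 0.
  rewrite -sqrf_eq0 /diamond dM_right_sqr.
  have: cm_diamond (diamond z i j) by apply: z_cm; lia.
  rewrite /diamond => /cm_diamondE ->; rewrite mulr0 subr0.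
  have [|H1 _] := z_heron i j; first by lia.
  have [|_ H2] := z_heron i (j + 1); first by lia.
  by rewrite addrK in H2; rewrite !mulf_neq0 // pnatr_eq0.
have eq_right : diamond w i j = diamond z i j.
  by rewrite /diamond eq_slash eq_backslash !eq_node //; lia.
have eq_up : diamond w (i - 1) j = diamond z (i - 1) j.
  by rewrite /diamond !subrK eq_slash eq_backslash !eq_node //; lia.
have eq_down : diamond w i (j - 1) = diamond z i (j - 1).
  by rewrite /diamond !subrK eq_slash eq_backslash !eq_node //; lia.
have: dM_left (diamond w (i - 1) (j - 1)) = dM_left (diamond z (i - 1) (j - 1)).
  apply: (mulIf z_right); rewrite z_coh // -eq_right -eq_up -eq_down.
  exact: w_coh.
rewrite /diamond !dM_leftE !subrK eq_slash eq_backslash.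
rewrite !(eq_node i, eq_node (i - 1) j); try lia.
set a := z (node (i - 1) j); set b := z (slash _).
set c := z (node i (j - 1)); set d := z (backslash _).
set f := z (node i j); set e := w _; set g := z (node (i - 1) (j - 1)).
move/eqP; rewrite -subr_eq0 => /eqP E.
have: 4 * f * (g - e) = 0 by rewrite -E; ring.
by move/eqP; rewrite !mulf_eq0 pnatr_eq0 (negPf (z_nodes _ _ _)) //= subr_eq0
  => /eqP.
Qed.

(** * Periodicity and propagation in the lattice *)

Lemma periodic_all (P : int -> Prop) (n : nat) (c : int) :
  (forall i, P (i + n%:Z) <-> P i) ->
  (forall i, c <= i < c + n%:Z -> P i) -> (0 < n)%N -> forall i, P i.
Proof.
move=> P_per P_base n_gt0 i.
have P_iter (m : nat) k : P (k + (m * n)%N%:Z) <-> P k.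
  elim: m => [|m IHm]; first by rewrite mul0n addr0.
  by rewrite mulSn addnC PoszD addrA P_per.
have n_neq0 : n%:Z != 0 by lia.
have r_ge0 := modz_ge0 (i - c) n_neq0.
have r_lt := ltz_mod (i - c) n_neq0.
have := divz_eq (i - c) n%:Z; move: r_ge0 r_lt.
set r := modz _ _ => r_ge0 r_lt.
case: (divz (i - c) n%:Z) => m E.
  have -> : i = (r + c) + (m * n)%N%:Z by lia.
  by apply/P_iter/P_base; lia.
(* A negative quotient [Negz m] stands for -(m + 1), so i is shifted up by m + 1 periods. *)
apply/(P_iter m.+1); have -> : i + (m.+1 * n)%N%:Z = r + c by lia.
by apply: P_base; lia.
Qed.

(** These are the only unit moves that raise j - i by one. *)
Definition lattice_step (i j i' j' : int) : Prop :=
  (i' = i /\ j' = j + 1) \/ (i' = i - 1 /\ j' = j).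

Lemma path_monotone (n : nat) (a b : nat -> int) :
  (forall k, (1 <= k <= n - 2)%N ->
    lattice_step (a k) (b k) (a k.+1) (b k.+1)) ->
  forall k l, (1 <= k)%N -> (k <= l <= n - 1)%N -> a l <= a k /\ b k <= b l.
Proof.
move=> step k; elim=> [|l IHl] k_gt0 /andP[kl ln]; first by lia.
have [->|k_neq] := eqVneq k l.+1; first by rewrite !lexx.
have [||] := IHl; [lia|lia|].
by have := step l; case=> [|[-> ->]|[-> ->]]; lia.
Qed.

Lemma spread_right (n : nat) (D : int -> int -> Prop) (a b : nat -> int) :
  (forall k, (1 <= k <= n - 1)%N -> b k - a k = k%:Z) ->
  (forall k, (1 <= k <= n - 2)%N ->
    lattice_step (a k) (b k) (a k.+1) (b k.+1)) ->
  (forall k, (1 <= k <= n - 1)%N -> D (a k) (b k) /\ D (a k + 1) (b k + 1)) ->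
  (forall i j, 0 <= j - i <= 1 \/ n%:Z - 1 <= j - i <= n%:Z -> D i j) ->
  (forall i j, 2 <= j - i <= n%:Z - 2 ->
    (forall i' j', i - 1 <= i' <= i + 1 -> j - 1 <= j' <= j + 1 ->
       i' + j' < (i + 1) + (j + 1) -> D i' j') -> D (i + 1) (j + 1)) ->
  forall (k : nat) (i j : int), (2 <= k <= n - 2)%N -> j - i = k%:Z ->
    a k <= i -> D i j.
Proof.
move=> level step D_path D_bd D_right k i j.
have mono := path_monotone step.
(* The coordinates [a] and [b] are least at levels n - 1 and 1, so this sum bounds i + j from below
   on the region, and the base case is vacuous. *)
have [m] : exists m : nat, i + j < a (n - 1)%N + b 1%N + m%:Z.
  by exists (absz (i + j - (a (n - 1)%N + b 1%N) + 1)); lia.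
elim: m k i j => [|m IHm] k i j ij_m k_n ij_k ai.
  have [||] := mono k (n - 1)%N; [lia..|].
  have [||] := mono 1%N k; [lia..|].
  by have := level k; lia.
have lk := level k; have Dk := D_path k.
have [i_eq|i_neq] := eqVneq i (a k).
  have -> : j = b k by lia.
  by rewrite i_eq; case: Dk => //; lia.
have [i_eq|i_neq1] := eqVneq i (a k + 1).
  have -> : j = b k + 1 by lia.
  by rewrite i_eq; case: Dk => //; lia.
(* Now i >= a k + 2, so the whole block centred at (i - 1, j - 1) stays in the region. *)
rewrite -(subrK 1 i) -(subrK 1 j); apply: D_right; first by lia.
move=> i' j' i'_i j'_j ij'.
have [k' k'E] : exists k' : nat, j' - i' = k'%:Z.
  by exists (absz (j' - i')); lia.
have [k'_n|k'_bd] := boolP ((2 <= k') && (k' <= n - 2))%N; last first.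
  by apply: D_bd; lia.
apply: (IHm k') => //; first by lia.
have lk' := level k'.
(* If k <= k', then a k' <= a k <= i - 2 <= i'. Otherwise b k' <= b k <= j - 2 <= j' gives the same
   bound through the level. *)
have [le_k|lt_k] := leqP k k'.
  by have [||] := mono k k'; [lia..|lia].
by have [||] := mono k' k; [lia..|lia].
Qed.

Lemma spread_left (n : nat) (D : int -> int -> Prop) (a b : nat -> int) :
  (forall k, (1 <= k <= n - 1)%N -> b k - a k = k%:Z) ->
  (forall k, (1 <= k <= n - 2)%N ->
    lattice_step (a k) (b k) (a k.+1) (b k.+1)) ->
  (forall k, (1 <= k <= n - 1)%N -> D (a k) (b k) /\ D (a k + 1) (b k + 1)) ->
  (forall i j, 0 <= j - i <= 1 \/ n%:Z - 1 <= j - i <= n%:Z -> D i j) ->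
  (forall i j, 2 <= j - i <= n%:Z - 2 ->
    (forall i' j', i - 1 <= i' <= i + 1 -> j - 1 <= j' <= j + 1 ->
       (i - 1) + (j - 1) < i' + j' -> D i' j') -> D (i - 1) (j - 1)) ->
  forall (k : nat) (i j : int), (2 <= k <= n - 2)%N -> j - i = k%:Z ->
    i <= a k -> D i j.
Proof.
move=> level step D_path D_bd D_left k i j.
have mono := path_monotone step.
have [m] : exists m : nat, a 1%N + b (n - 1)%N < i + j + m%:Z.
  by exists (absz (a 1%N + b (n - 1)%N - (i + j) + 1)); lia.
elim: m k i j => [|m IHm] k i j ij_m k_n ij_k ai.
  have [||] := mono k (n - 1)%N; [lia..|].
  have [||] := mono 1%N k; [lia..|].
  by have := level k; lia.
have lk := level k; have Dk := D_path k.
have [i_eq|i_neq] := eqVneq i (a k).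
  have -> : j = b k by lia.
  by rewrite i_eq; case: Dk => //; lia.
rewrite -(addrK 1 i) -(addrK 1 j); apply: D_left; first by lia.
move=> i' j' i'_i j'_j ij'.
have [k' k'E] : exists k' : nat, j' - i' = k'%:Z.
  by exists (absz (j' - i')); lia.
have [k'_n|k'_bd] := boolP ((2 <= k') && (k' <= n - 2))%N; last first.
  by apply: D_bd; lia.
have lk' := level k'; have Dk' := D_path k'.
(* Only i <= a k - 1 is known here, so the block may reach one unit past the path; those nodes lie
   on the thickening. *)
have [i_eq|i_neq1] := eqVneq i' (a k' + 1).
  have -> : j' = b k' + 1 by lia.
  by rewrite i_eq; case: Dk' => //; lia.
apply: (IHm k') => //; first by lia.
have [le_k|lt_k] := leqP k k'.
  by have [||] := mono k k'; [lia..|lia].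
by have [||] := mono k' k; [lia..|lia].
Qed.

Lemma traversing_step (n : nat) (p : cm_path) (k : nat) :
  traversing n p -> (1 <= k <= n - 2)%N ->
  lattice_step (path_i p k) (path_j p k) (path_i p k.+1) (path_j p k.+1).
Proof.
move=> [level step _] k_n; have := step k k_n.
have := level k; have := level k.+1; rewrite /lattice_step; lia.
Qed.

(** * Values on the lines *)

Lemma frieze_boundary (R : realType) (n : nat) (z : cm_array R) :
  cm_frieze n z -> forall i : int,
    [/\ z (slash i) = z (backslash i),
        z (node i (i + 1)) = z (backslash i),
        z (node i (i + n%:Z - 1)) = z (backslash (i - 1))
      & z (backslash (i + n%:Z)) = z (backslash i)].
Proof.
move=> [_ z_bd] i; have [_ [e1 e2] _ [e3 _]] := z_bd i.
have [_ [_ e4] _ _] := z_bd (i - 1); have [_ _ _ [_ e5]] := z_bd (i + 1).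
split=> //; first by rewrite e1.
  by rewrite e3.
(* Both [backslash i] and [backslash (i + n)] carry the value of [slash i], by the boundary
   conditions at i and at i + 1. *)
by rewrite -e2; move: e5; rewrite addrK addrAC addrK => ->.
Qed.

Lemma lines_determined (R : realType) (n : nat) (z w : cm_array R)
    (p : cm_path) :
  (4 <= n)%N -> cm_frieze n z -> cm_frieze n w -> traversing n p ->
  (forall x, in_path n p x -> w x = z x) ->
  (forall i, w (backslash i) = z (backslash i)) /\
  (forall i, w (slash i) = z (slash i)).
Proof.
move=> n_ge4 z_frieze w_frieze p_trav eq_path.
have z_bd := frieze_boundary z_frieze; have w_bd := frieze_boundary w_frieze.
suff eq_bs : forall i, w (backslash i) = z (backslash i).
  split=> // i; have [-> _ _ _] := z_bd i; have [-> _ _ _] := w_bd i.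
  exact: eq_bs.
have [level _ line] := p_trav.
have eq_node k : (1 <= k <= n - 1)%N ->
    w (node (path_i p k) (path_j p k)) = z (node (path_i p k) (path_j p k)).
  by move=> k_n; apply: eq_path; left; exists k.
(* The interval starts as one index, read off the level-one node. Each step extends it by one: at
   the right end through a backslash line, at the left end through a slash line. *)
have crossed k : (1 <= k <= n - 1)%N -> forall i,
    path_i p k <= i < path_j p k -> w (backslash i) = z (backslash i).
  elim: k => // k IHk k_n i i_k.
  have [k0|k_gt0] := posnP k.
    have := level k.+1 k_n; have := eq_node k.+1 k_n; rewrite k0 => eq1 lev1.
    have -> : i = path_i p 1 by move: i_k; rewrite k0; lia.
    move: eq1; have -> : path_j p 1 = path_i p 1 + 1 by lia.
    have [_ -> _ _] := z_bd (path_i p 1).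
    by have [_ -> _ _] := w_bd (path_i p 1).
  have k_n2 : (1 <= k <= n - 2)%N by lia.
  have eq_line : w (path_line p k) = z (path_line p k).
    by apply: eq_path; right; exists k.
  have {}IHk : forall i, path_i p k <= i < path_j p k ->
      w (backslash i) = z (backslash i) by apply: IHk; lia.
  have [_ down up] := line k k_n2.
  have [[iE jE]|[iE jE]] := traversing_step p_trav k_n2.
    have [->|i_neq] := eqVneq i (path_j p k); first by rewrite -up.
    by apply: IHk; lia.
  have [->|i_neq] := eqVneq i (path_i p k - 1); last by apply: IHk; lia.
  have [<- _ _ _] := z_bd (path_i p k - 1).
  by have [<- _ _ _] := w_bd (path_i p k - 1); rewrite -down.
apply: (@periodic_all _ n (path_i p (n - 1)%N - 1)); last by lia.
  by move=> i; have [_ _ _ ->] := z_bd i; have [_ _ _ ->] := w_bd i.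
move=> i i_n; have lev : path_j p (n - 1)%N - path_i p (n - 1)%N = (n - 1)%N%:Z.
  by apply: level; lia.
(* The crossed interval has only n - 1 indices; the one just before it completes a period and is
   read off the last node of the path. *)
have [->|i_neq] := eqVneq i (path_i p (n - 1)%N - 1).
  have := eq_node (n - 1)%N.
  have -> : path_j p (n - 1)%N = path_i p (n - 1)%N + n%:Z - 1 by lia.
  have [_ _ -> _] := z_bd (path_i p (n - 1)%N).
  have [_ _ -> _] := w_bd (path_i p (n - 1)%N).
  by apply; lia.
by apply: (crossed (n - 1)%N); lia.
Qed.

Theorem theorem5p18 (R : realType) (n : nat) (hn : (4 <= n)%N)
    (z : cm_array R) (z_frieze : cm_frieze n z) (z_coherent : coherent n z)
    (z_nodes : nonzero_nodes n z) (z_heron : nonzero_heron n z)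
    (p : cm_path) (p_traversing : traversing n p)
    (w : cm_array R) (w_frieze : cm_frieze n w) (w_coherent : coherent n w)
    (w_nodes : nonzero_nodes n w) (w_heron : nonzero_heron n w)
    (w_eq_z : forall x : cm_index, in_thickening n p x -> w x = z x) :
  eq_array n w z.
Proof.
have [eq_bs eq_sl] : (forall i, w (backslash i) = z (backslash i)) /\
    (forall i, w (slash i) = z (slash i)).
  apply: (lines_determined hn z_frieze w_frieze p_traversing) => x x_p.
  by apply: w_eq_z; left.
pose D i j := w (node i j) = z (node i j).
have D_bd i j : 0 <= j - i <= 1 \/ n%:Z - 1 <= j - i <= n%:Z -> D i j.
  move=> ij_n; have [_ /(_ i) [z1 [z2 _] z3 [z4 _]]] := z_frieze.
  have [_ /(_ i) [w1 [w2 _] w3 [w4 _]]] := w_frieze; rewrite /D.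
  have [->|->|->|->] : [\/ j = i, j = i + 1, j = i + n%:Z - 1 | j = i + n%:Z].
  - have [->|?] := eqVneq j i; first by constructor 1.
    have [->|?] := eqVneq j (i + 1); first by constructor 2.
    have [->|?] := eqVneq j (i + n%:Z - 1); first by constructor 3.
    by constructor 4; lia.
  - by rewrite z1 w1.
  - by rewrite z2 w2.
  - by rewrite z4 w4.
  - by rewrite z3 w3.
have D_path k : (1 <= k <= n - 1)%N ->
    D (path_i p k) (path_j p k) /\ D (path_i p k + 1) (path_j p k + 1).
  move=> k_n; split; apply: w_eq_z; last by right; exists k.
  by left; left; exists k.
have step k := @traversing_step n p k p_traversing.
have [level _ _] := p_traversing.
case=> [i j|i _|j _]; [rewrite /= => ij_n | exact: eq_sl | exact: eq_bs].
have [k kE] : exists k : nat, j - i = k%:Z by exists (absz (j - i)); lia.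
have [k_n|k_bd] := boolP ((2 <= k) && (k <= n - 2))%N; last by apply: D_bd; lia.
(* The path cuts each level at [path_i p k]; the two sides are filled separately. *)
have [le_i|/ltW le_i] := lerP i (path_i p k).
  apply: (spread_left level step D_path D_bd) kE le_i => // i' j' ij' D_nb.
  exact: (node_left_determined ij').
apply: (spread_right level step D_path D_bd) kE le_i => // i' j' ij' D_nb.
exact: (node_right_determined ij').
Qed.
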